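(* Let $\Bbbk$ be a field, $W\subseteq\Bbbk^n$ a linear realization of a matroid $\mathcal M$ on $[n]$, and $\mathfrak a=(f_1g_1,\dots,f_ng_n)\subseteq S$ its ideal of pairs. Then: (a) every associated prime of $S/\mathfrak a$ is of the form $\mathfrak p_{F,G}$ for some biflat $(F,G)$; (b) the minimal primes of $S/\mathfrak a$ are exactly the ideals $\mathfrak p_{F,F^\complement}$ for $F\in\operatorname{cyc}(\mathcal M)$; in particular $V(\mathfrak a)=\bigcup_{F\in\operatorname{cyc}(\mathcal M)}V(\mathfrak p_{F,F^\complement})$; (c) for $F\in\operatorname{cyc}(\mathcal M)$, the primary component of $\mathfrak a$ corresponding to the minimal prime $\mathfrak p_{F,F^\complement}$ is $\mathfrak p_{F,F^\complement}$ itself.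
   Context: A linear realization of $\mathcal M$ (rank $r$) is an $r$-dimensional $W\subseteq\Bbbk^n$ such that $W\to\Bbbk^n\to\Bbbk^B$ (coordinate projection) is an isomorphism iff $B$ is a basis. Identify $\Bbbk^n$ with its dual; $W^\perp=\{y:\sum x_iy_i=0\ \forall x\in W\}$ realizes the dual matroid $\mathcal M^\perp$. $f_i\in W^*$ and $g_i\in(W^\perp)^*$ are the restrictions of the $i$-th coordinate function; $R=\Bbbk[W]$, $R^\perp=\Bbbk[W^\perp]$, $S=R\otimes_\Bbbk R^\perp$. For $I,J\subseteq[n]$, $\mathfrak p_{I,J}=(f_i:i\in I)+(g_j:j\in J)\subseteq S$. $L(\mathcal M)$ is the set of flats of $\mathcal M$. A biflat is a pair $(F,G)\in L(\mathcal M)\times L(\mathcal M^\perp)$ with $F\cup G=[n]$. A flat is cyclic if it is a union of circuits; $\operatorname{cyc}(\mathcal M)$ is the set of cyclic flats; $F^\complement=[n]\setminus F$. $V(\cdot)$ denotes the zero locus in $\operatorname{Spec}S$. *)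

(* Defs.v *)
From mathcomp Require Import all_boot all_order all_algebra.

Set Implicit Arguments.
Unset Strict Implicit.
Unset Printing Implicit Defensive.

Section Matroids.
Local Open Scope set_scope.
Variable E : finType.

Record matroid := Matroid {
  bases : {set {set E}};
  bases_neq0 : bases != set0;
  bases_exchange : forall B1 B2 : {set E}, B1 \in bases -> B2 \in bases ->
    forall x, x \in B1 :\: B2 ->
    exists2 y, y \in B2 :\: B1 & y |: (B1 :\ x) \in bases
}.

Lemma card_bases (M : matroid) (B1 B2 : {set E}) :
  B1 \in bases M -> B2 \in bases M -> #|B1| = #|B2|.
Proof.
suff H m : forall B1 B2 : {set E}, #|B1 :\: B2| = m ->
    B1 \in bases M -> B2 \in bases M -> (#|B1| <= #|B2|)%N.
  by move=> b1 b2; apply/eqP; rewrite eqn_leq !(H _ _ _ erefl).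
elim: m => [|m IH] {}B1 {}B2 cB b1 b2.
  by apply: subset_leq_card; rewrite -setD_eq0 -cards_eq0 cB.
have /card_gt0P[x xD] : (0 < #|B1 :\: B2|)%N by rewrite cB.
have [y yD b3] := bases_exchange b1 b2 xD.
move: (xD) (yD); rewrite !inE => /andP[xB2 xB1] /andP[yB1 yB2].
have c3 : #|y |: (B1 :\ x)| = #|B1|.
  by rewrite cardsU1 !inE (negPf yB1) andbF (cardsD1 x B1) xB1.
rewrite -c3; apply: IH => //.
apply/eqP; rewrite -eqSS -cB (cardsD1 x (B1 :\: B2)) xD add1n eqSS.
apply/eqP/eq_card => z; rewrite !inE.
have [->|zy] /= := eqVneq z y; first by rewrite yB2 /= andbF.
by case: (z == x); rewrite ?andbF.
Qed.

Lemma bases_dual_exchange (M : matroid) (B1 B2 : {set E}) :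
  B1 \in bases M -> B2 \in bases M ->
  forall x, x \in B2 :\: B1 ->
  exists2 y, y \in B1 :\: B2 & x |: (B1 :\ y) \in bases M.
Proof.
move=> b1 b2 x; rewrite inE => /andP[xB1 xB2].
suff H m : forall B : {set E}, #|B :\: B1| = m ->
    B \in bases M -> x \in B -> B1 :&: B2 \subset B ->
    exists2 y, y \in B1 :\: B2 & x |: (B1 :\ y) \in bases M.
  by apply: (H _ B2 erefl) => //; apply: subsetIr.
elim: m => [|m IH] B cB b xB sB.
  by move/eqP: cB; rewrite cards_eq0 => /eqP/setP/(_ x); rewrite !inE xB xB1.
have [[z zx zD]|noz] : (exists2 z, z != x & z \in B :\: B1) \/
    (forall z, z \in B :\: B1 -> z = x).
  case: (pickP [pred z | (z != x) && (z \in B :\: B1)]) => [z /andP[]|h].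
    by left; exists z.
  by right=> z zD; apply/eqP; move: (h z); rewrite inE zD andbT => /negbFE.
- have [y yD b3] := bases_exchange b b1 zD.
  move: (zD) (yD); rewrite !inE => /andP[zB1 zB] /andP[yB yB1].
  apply: (IH (y |: (B :\ z))) => //.
  + apply/eqP; rewrite -eqSS -cB (cardsD1 z (B :\: B1)) zD add1n eqSS.
    apply/eqP/eq_card => t; rewrite !inE.
    have [->|ty] /= := eqVneq t y; first by rewrite yB1 /= andbF.
    by case: (t == z); rewrite ?andbF.
  + by rewrite !inE [x == z]eq_sym zx xB orbT.
  apply/subsetP=> t tI; rewrite !inE (subsetP sB) // andbT.
  case: (eqVneq t z) => [tz|_]; last by rewrite orbT.
  by move: tI; rewrite inE tz (negPf zB1).
have BD : B :\: B1 = [set x].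
  apply/setP=> t; rewrite in_set1; apply/idP/eqP => [/noz//|->].
  by rewrite inE xB1 xB.
have c1 : #|B1 :\: B| = 1%N.
  have := card_bases b1 b; rewrite -(cardsID B B1) -(cardsID B1 B) BD cards1.
  by rewrite setIC => /eqP; rewrite eqn_add2l => /eqP.
have /cards1P[y B1D] : #|B1 :\: B| == 1%N by rewrite c1.
have /setDP[yB1 yB] : y \in B1 :\: B by rewrite B1D set11.
exists y.
  rewrite inE yB1 andbT; apply: contra yB => yB2.
  by apply: (subsetP sB); rewrite inE yB1.
suff -> : x |: (B1 :\ y) = B by [].
apply/setP=> t; have := congr1 (fun A : {set E} => t \in A) BD.
have := congr1 (fun A : {set E} => t \in A) B1D.
rewrite !inE => <-.
by case: (t \in B1) (t \in B) => [] [] //= <-.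
Qed.

Definition dual_bases (M : matroid) : {set {set E}} := [set ~: B | B in bases M].

Lemma dual_bases_neq0 (M : matroid) : dual_bases M != set0.
Proof.
by have /set0Pn[B b] := bases_neq0 M; apply/set0Pn; exists (~: B); apply: imset_f.
Qed.

Lemma dual_bases_exchange (M : matroid) (B1 B2 : {set E}) :
  B1 \in dual_bases M -> B2 \in dual_bases M ->
  forall x, x \in B1 :\: B2 ->
  exists2 y, y \in B2 :\: B1 & y |: (B1 :\ x) \in dual_bases M.
Proof.
case/imsetP=> C1 b1 -> /imsetP[C2 b2 ->] x.
rewrite !inE negbK => /andP[x2 x1].
have xD : x \in C2 :\: C1 by rewrite inE x1.
have [y /setDP[y1 y2] b3] := bases_dual_exchange b1 b2 xD.
exists y; first by rewrite !inE y1 y2.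
suff -> : y |: (~: C1 :\ x) = ~: (x |: (C1 :\ y)) by apply: imset_f.
apply/setP=> t; rewrite !inE.
have [->|ty] := eqVneq t y; last by rewrite /= !negb_or.
by rewrite /= orbF; apply/esym; apply: contraNneq x1 => <-.
Qed.

Definition dual (M : matroid) : matroid :=
  Matroid (dual_bases_neq0 M) (@dual_bases_exchange M).

Variable M : matroid.

Definition rank (A : {set E}) : nat := \max_(B in bases M) #|A :&: B|.

Definition indep (A : {set E}) : bool := [exists B in bases M, A \subset B].

Definition circuit (C : {set E}) : bool := minset (fun D => ~~ indep D) C.

Definition flat (F : {set E}) : bool :=
  [forall i, (i \notin F) ==> (rank F < rank (i |: F))%N].

Definition cyclic_flat (F : {set E}) : bool :=
  flat F &&
  [exists P : {set {set E}}, [forall C in P, circuit C] && (F == cover P)].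

End Matroids.

Definition biflat (E : finType) (M : matroid E) (F G : {set E}) : bool :=
  [&& flat M F, flat (dual M) G & (F :|: G == [set: E])%SET].

From mathcomp Require Import boolp classical_sets mpoly.

Import GRing.Theory.

Section Ideals.
Local Open Scope ring_scope.
Local Open Scope classical_set_scope.
Variable A : comNzRingType.
Implicit Types I J P Q : set A.

Definition generated_ideal (T : finType) (D : {set T}) (h : T -> A) : set A :=
  [set x | exists c : T -> A, x = \sum_(i in D) c i * h i].

Definition ideal_sum I J : set A :=
  [set x | exists u v, [/\ I u, J v & x = u + v]].

(* idealr_closed only holds of proper ideals *)
Definition prime_ideal P : Prop :=
  idealr_closed (mem P) /\ prime_idealr_closed (mem P).

(* the prime ideals that are annihilators of elements of A / I *)
Definition associated_prime I P : Prop :=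
  prime_ideal P /\ exists x : A, P = [set y | I (y * x)].

Definition minimal_prime I P : Prop :=
  [/\ prime_ideal P, I `<=` P &
      forall Q, prime_ideal Q -> I `<=` Q -> Q `<=` P -> Q = P].

Definition Spec : set (set A) := [set P | prime_ideal P].

Definition zero_locus I : set (set A) := Spec `&` [set P | I `<=` P].

Definition radical I : set A := [set x | exists m : nat, I (x ^+ m)].

Definition primary_ideal Q : Prop :=
  idealr_closed (mem Q) /\ forall x y, Q (x * y) -> Q x \/ radical Q y.

Definition minimal_primary_decomposition I (m : nat) (q : 'I_m -> set A) : Prop :=
  [/\ forall j, primary_ideal (q j),
      I = \bigcap_j q j,
      injective (fun j => radical (q j)) &
      forall j, ~ (\bigcap_(i in [set i | i != j]) q i `<=` q j)].

Definition primary_component I P Q : Prop :=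
  exists (m : nat) (q : 'I_m -> set A),
    minimal_primary_decomposition I q /\
    exists j, q j = Q /\ radical (q j) = P.

End Ideals.

Section Realizations.
Local Open Scope ring_scope.
Variables (k : fieldType) (n : nat).
Implicit Types W : {vspace 'rV[k]_n}.

Definition dot (x y : 'rV[k]_n) : k := \sum_i x 0 i * y 0 i.

Definition orth W : {vspace 'rV[k]_n} :=
  (\bigcap_(j < \dim W)
     lker (linfun (mulmxr ((vbasis W)`_j)^T : 'rV[k]_n -> 'rV[k]_1)))%VS.

Lemma orthP W (y : 'rV[k]_n) :
  reflect {in W, forall x, dot x y = 0} (y \in orth W).
Proof.
have E (x : 'rV[k]_n) : (y *m x^T == 0) = (dot x y == 0).
  have -> : y *m x^T = (dot x y)%:M.
    apply/matrixP=> i j; rewrite !ord1 !mxE eqxx mulr1n.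
    by apply: eq_bigr => l _; rewrite !mxE mulrC.
  by rewrite -scalemx1 scaler_eq0 oner_eq0 orbF.
have dotD : {morph dot^~ y : a b / a + b}.
  move=> a b; rewrite /dot -big_split /=.
  by apply: eq_bigr => l _; rewrite !mxE mulrDl.
have dotZ c a : dot (c *: a) y = c * dot a y.
  by rewrite /dot mulr_sumr; apply: eq_bigr => l _; rewrite !mxE mulrA.
have dot0 : dot 0 y = 0 by rewrite -(scale0r (0 : 'rV[k]_n)) dotZ mul0r.
apply: (iffP idP) => [yW x xW|yW].
  rewrite (coord_vbasis xW) (big_morph _ dotD dot0) big1 // => j _.
  rewrite dotZ; move: yW; rewrite memvE => /subv_bigcapP/(_ j isT).
  by rewrite -memvE memv_ker lfunE /= E => /eqP->; rewrite mulr0.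
rewrite memvE; apply/subv_bigcapP => j _.
rewrite -memvE memv_ker lfunE /= E; apply/eqP/yW/vbasis_mem/mem_nth.
by rewrite size_tuple.
Qed.

Definition coord_proj W (B : {set 'I_n}) (w : subvs_of W) :
    {ffun {i : 'I_n | i \in B} -> k} :=
  [ffun i => vsval w 0 (val i)].

Definition linear_realization (M : matroid 'I_n) W : Prop :=
  \dim W = rank M [set: 'I_n]%SET /\
  forall B : {set 'I_n}, bijective (@coord_proj W B) <-> B \in bases M.

(* k[W] (x) k[W^perp]: the first \dim W variables are the coordinates on W in
   the basis vbasis W, and the remaining ones are the coordinates on the
   orthogonal space in the basis vbasis (orth W). *)
Definition pair_ring W := {mpoly k[\dim W + \dim (orth W)]}.

Definition coord_f W (i : 'I_n) : pair_ring W :=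
  \sum_(j < \dim W) (vbasis W)`_j 0 i *: 'X_(lshift (\dim (orth W)) j).

Definition coord_g W (i : 'I_n) : pair_ring W :=
  \sum_(j < \dim (orth W)) (vbasis (orth W))`_j 0 i *: 'X_(rshift (\dim W) j).

Definition pair_point W (w w' : 'rV[k]_n) (j : 'I_(\dim W + \dim (orth W))) : k :=
  match fintype.split j with
  | inl a => coord (vbasis W) a w
  | inr b => coord (vbasis (orth W)) b w'
  end.

Lemma coord_fE W i w w' : w \in W -> (coord_f W i).@[pair_point w w'] = w 0 i.
Proof.
move=> wW; rewrite {2}(coord_vbasis wW) summxE raddf_sum /=.
apply: eq_bigr => j _; rewrite mevalZ mevalXU /pair_point mxE.
by rewrite (unsplitK (inl j)) mulrC.
Qed.

Lemma coord_gE W i w w' :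
  w' \in orth W -> (coord_g W i).@[pair_point w w'] = w' 0 i.
Proof.
move=> wW; rewrite {2}(coord_vbasis wW) summxE raddf_sum /=.
apply: eq_bigr => j _; rewrite mevalZ mevalXU /pair_point mxE.
by rewrite (unsplitK (inr j)) mulrC.
Qed.

Definition ideal_of_pairs W : set (pair_ring W) :=
  generated_ideal [set: 'I_n]%SET (fun i => coord_f W i * coord_g W i).

Definition coord_ideal W (I J : {set 'I_n}) : set (pair_ring W) :=
  ideal_sum (generated_ideal I (coord_f W)) (generated_ideal J (coord_g W)).

End Realizations.

Arguments ideal_of_pairs {k n} W _.
Arguments coord_ideal {k n} W I J _.

(* Main.v *)
From HB Require Import structures.
Require Import Defs.
From mathcomp Require Import all_boot all_order all_algebra.
From mathcomp Require Import boolp.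

(** Let P be a prime containing a, let I and J index the f_i and the g_j lying in P,
    and let u be the product of the f_i, i \notin I, and the g_j, j \notin J.
    Inverting u turns a into an ideal b generated by polynomials in the linear forms
    belonging to P, so S/b is torsion-free over the polynomial ring on a complementary
    space of linear forms.  If moreover P = (a : x), then P = (b : x), and
    torsion-freeness leaves no room in P beyond p_(I,J).  By the Fredholm alternative,
    I and J are flats of M and of its dual, and the closure F of the complement of J is
    a cyclic flat with p_(F,~F) contained in P; distinct cyclic flats give incomparable
    primes, as evaluation at points shows.  When I = F and J = ~F, the ideal b is
    p_(F,~F) itself, so that u p_(F,~F) is contained in a, which determines the primary
    component; primary decompositions exist by the theorems of Hilbert and
    Lasker-Noether. *)

Set Implicit Arguments.
Unset Strict Implicit.
Unset Printing Implicit Defensive.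

Import GRing.Theory.

(** * Representations of matroids and orthogonality *)

Section LinearAlgebra.
Local Open Scope ring_scope.
Variables (k : fieldType) (n : nat).
Implicit Types (U W : {vspace 'rV[k]_n}) (A B F : {set 'I_n}).

Lemma dotC (x y : 'rV[k]_n) : dot x y = dot y x.
Proof. by apply: eq_bigr => i _; rewrite mulrC. Qed.

Lemma dot_delta i (y : 'rV[k]_n) : dot (delta_mx 0 i) y = y 0 i.
Proof.
rewrite /dot (bigD1 i) //= mxE !eqxx mul1r big1 ?addr0 // => j ji.
by rewrite mxE (negPf ji) andbF mul0r.
Qed.

(** The columns of [cokermx B], for [B] the matrix of a basis of [U], are orthogonal to [U], and
    together they annihilate only the row space of [B]. *)
Lemma orth_separates U v :
  v \notin U -> exists2 y, y \in orth U & dot v y != 0.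
Proof.
move=> vU; pose B := \matrix_(i < \dim U) (vbasis U)`_i.
have BE (c : 'rV[k]_(\dim U)) : c *m B = \sum_i c 0 i *: (vbasis U)`_i.
  by rewrite mulmx_sum_row; apply: eq_bigr => i _; rewrite rowK.
have dotE (x : 'rV[k]_n) j : dot x (col j (cokermx B))^T = (x *m cokermx B) 0 j.
  by rewrite mxE; apply: eq_bigr => i _; rewrite !mxE.
have : ~~ (v <= B)%MS.
  apply: contra vU => /submxP[c ->]; rewrite BE.
  apply: rpred_sum => i _; apply/rpredZ/vbasis_mem/mem_nth.
  by rewrite size_tuple.
rewrite submxE => /eqP vB.
have [j vj] : exists j, (v *m cokermx B) 0 j != 0.
  apply/existsP; apply: contra_notT vB => /existsPn h.
  by apply/rowP => j; rewrite [RHS]mxE; apply/eqP; rewrite -[_ == _]negbK.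
exists (col j (cokermx B))^T; last by rewrite dotE.
apply/orthP => x xU; rewrite dotE.
have -> : x = (\row_i coord (vbasis U) i x) *m B.
  by rewrite BE {1}(coord_vbasis xU); apply: eq_bigr => i _; rewrite mxE.
by rewrite -mulmxA mulmx_coker mulmx0 mxE.
Qed.

Lemma orthK W : orth (orth W) = W.
Proof.
apply/vspaceP => v; apply/idP/idP => [/orthP vO|vW]; last first.
  by apply/orthP => x /orthP xO; rewrite dotC xO.
apply: contraTT isT => /orth_separates[y yO].
by rewrite dotC vO ?eqxx.
Qed.

(** Dually: on [W] the coordinate form f_i is not in the span of the f_j with [j] in [A], so that
    [i] lies outside the closure of [A]. *)
Definition separates W A i :=
  exists w : 'rV[k]_n, [/\ w \in W, forall j, j \in A -> w 0 j = 0 & w 0 i != 0].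

Lemma separates_notin W A i : separates W A i -> i \notin A.
Proof. by case=> w [_ wA wi]; apply: contra wi => /wA ->. Qed.

Lemma separatesS W A B i : A \subset B -> separates W B i -> separates W A i.
Proof.
by move=> /subsetP sAB [w [wW wB wi]]; exists w; split=> // j /sAB/wB.
Qed.

(* The Fredholm alternative for e_i and the subspace W + k^(~: (i |: A)). *)
Lemma separates_orth W A i : i \notin A ->
  separates W A i <-> ~ separates (orth W) (~: (i |: A)) i.
Proof.
move=> iA; split=> [[w [wW wA wi]] [y [/orthP yO yA yi]]|nsep].
  have := yO _ wW; rewrite /dot (bigD1 i) //= big1 ?addr0 => [/eqP|j ji].
    by rewrite mulf_eq0 (negPf wi) (negPf yi).
  have [jA|jA] := boolP (j \in A); first by rewrite wA ?mul0r.
  by rewrite yA ?mulr0 // !inE negb_or ji jA.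
pose K := (\sum_(j | j \notin i |: A) <[delta_mx 0%R j : 'rV[k]_n]>)%VS.
have [|/orth_separates[y /orthP yO]] := boolP ((delta_mx 0 i) \in (W + K)%VS).
  case/memv_addP=> w wW [u /memv_sumP[v vK uE] iE].
  have u0 j : j \in i |: A -> u 0 j = 0.
    move=> jA; rewrite uE summxE big1 // => l lA.
    have /vlineP[c ->] := vK _ lA; rewrite !mxE /=.
    by case: eqP jA lA => [->->|]; rewrite ?mulr0.
  have wE j : j \in i |: A -> w 0 j = (j == i)%:R.
    move=> jA; have := congr1 (fun v : 'rV_n => v 0 j) iE.
    by rewrite !mxE u0 // addr0.
  exists w; split=> // [j jA|]; last by rewrite wE ?setU11 // eqxx oner_eq0.
  rewrite wE; last by rewrite inE jA orbT.
  by case: eqP jA iA => // ->->.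
rewrite dot_delta => yi; case: nsep; exists y; split=> //.
  by apply/orthP => x xW; apply/yO/(subvP (addvSl _ _)).
move=> j; rewrite inE => jA; rewrite -dot_delta; apply/yO.
apply: (subvP (addvSr _ _)); rewrite memvE; exact: (@sumv_sup _ _ _ j).
Qed.

(** Linear independence in the dual of [W] of the coordinate forms indexed by [A]; [spanning_coords]
    says that they span this dual. *)
Definition free_coords W A := forall i, i \in A -> separates W (A :\ i) i.

Definition spanning_coords W A := forall i, ~ separates W A i.

Lemma free_coords_orth W A :
  free_coords W A <-> spanning_coords (orth W) (~: A).
Proof.
split=> [fA i sep|sA i iA].
  have iA : i \in A by have := separates_notin sep; rewrite inE negbK.
  have /separates_orth[|] := fA _ iA; first by rewrite !inE eqxx.
  by rewrite setD1K.
apply/separates_orth; first by rewrite !inE eqxx.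
by rewrite setD1K.
Qed.

Lemma free_coords_sub W A B : A \subset B -> free_coords W B -> free_coords W A.
Proof.
move=> sAB fB i iA; apply: separatesS (fB _ (subsetP sAB _ iA)).
exact: setSD.
Qed.

Lemma free_coordsU1 W A i :
  free_coords W A -> separates W A i -> free_coords W (i |: A).
Proof.
move=> fA sep; have iA := separates_notin sep.
move=> j; rewrite in_setU1 => /predU1P[->|jA].
  by rewrite setU1K.
have ji : j != i by apply: contraNneq iA => <-.
have [w [wW wA wi]] := sep; have [v [vW vA vj]] := fA _ jA.
(* Subtracting a multiple of [w] clears coordinate [i] of [v] and changes no coordinate in [A]. *)
exists (v - (v 0 i / w 0 i) *: w); split.
- by rewrite rpredB ?rpredZ.
- move=> l; rewrite !inE => /andP[lj /predU1P[->|lA]].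
    by rewrite !mxE divfK // subrr.
  by rewrite !mxE (wA _ lA) mulr0 subr0 vA // !inE lj.
- by rewrite !mxE (wA _ jA) mulr0 subr0.
Qed.

(** Freeness amounts to surjectivity of the projection and spanning to its injectivity. *)
Lemma coord_proj_bij W B :
  bijective (@coord_proj k n W B) <-> free_coords W B /\ spanning_coords W B.
Proof.
split=> [bij|[fB sB]].
  split=> [i iB|i [w [wW wB wi]]].
    have [g _ gK] := bij.
    pose d := g [ffun j => (val j == i)%:R].
    have dE j : j \in B -> vsval d 0 j = (j == i)%:R.
      move=> jB.
      have := congr1 (fun f : {ffun _ -> k} => f (Sub j jB)) (gK [ffun j => (val j == i)%:R]).
      by rewrite !ffunE.
    exists (vsval d); split; first exact: subvsP.
      by move=> j; rewrite !inE => /andP[/negPf ji /dE->]; rewrite ji.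
    by rewrite dE // eqxx oner_eq0.
  have w0 : vsproj W w = 0.
    apply: (bij_inj bij); apply/ffunP => -[j jB]; rewrite !ffunE.
    by rewrite vsprojK //= wB // mxE.
  have : vsval (vsproj W w) 0 i = 0 by rewrite w0 mxE.
  by rewrite vsprojK // => wi0; rewrite wi0 eqxx in wi.
have inj : injective (@coord_proj k n W B).
  move=> x y xy; apply/eqP; rewrite -subr_eq0 -[_ == 0]negbK; apply/negP => nz.
  have : vsval (x - y) != 0.
    by apply: contra nz => /eqP e; apply/eqP/val_inj.
  case/rV0Pn => i vi; apply: (sB i); exists (vsval (x - y)).
  split=> // [|j jB]; first exact: subvsP.
  have := congr1 (fun f : {ffun _ -> k} => f (Sub j jB)) xy.
  by rewrite !ffunE /= !mxE => ->; rewrite subrr.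
have surj c : exists x, @coord_proj k n W B x = c.
  have /choice[w wP] (i : {i | i \in B}) : exists w : 'rV[k]_n,
      [/\ w \in W, forall j, j \in B :\ val i -> w 0 j = 0 & w 0 (val i) != 0].
    exact: fB (valP i).
  (* Interpolation: on [B] the vector [w i] is nonzero only at [i]. *)
  pose s := \sum_i (c i / w i 0 (val i)) *: w i.
  have sW : s \in W by apply: rpred_sum => i _; apply: rpredZ; case: (wP i).
  exists (vsproj W s); apply/ffunP => i; rewrite ffunE vsprojK // summxE.
  rewrite (bigD1 i) //= big1 ?addr0 => [|j ji].
    by rewrite mxE divfK //; case: (wP i).
  rewrite mxE; case: (wP j) => _ wj0 _; rewrite (wj0 (val i)) ?mulr0 //.
  rewrite !inE (valP i) andbT; apply: contra ji => /eqP e.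
  by apply/eqP/val_inj.
have [g gK] := choice surj.
by exists g => //; apply: inj_can_sym.
Qed.

End LinearAlgebra.

(** * Flats, circuits and cyclic flats of a represented matroid *)

Section Matroids.
Local Open Scope ring_scope.
Variables (k : fieldType) (n : nat).
Implicit Types (W : {vspace 'rV[k]_n}) (M : matroid 'I_n) (A B F : {set 'I_n}).

(** The form of a realization that passes to the dual through [free_coords_orth]. *)
Definition represents M W :=
  forall B, B \in bases M <-> free_coords W B /\ spanning_coords W B.

Lemma represents_dual M W : represents M W -> represents (dual M) (orth W).
Proof.
move=> rep B; have -> : (B \in bases (dual M)) = (~: B \in bases M).
  apply/imsetP/idP => [[C bC ->]|bB]; first by rewrite setCK.
  by exists (~: B); rewrite ?setCK.
rewrite rep; have := free_coords_orth W (~: B); rewrite setCK => ->.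
by have := free_coords_orth (orth W) B; rewrite orthK => ->; split=> -[].
Qed.

Variables (M : matroid 'I_n) (W : {vspace 'rV[k]_n}).
Hypothesis rep : represents M W.

(** A maximal free set spans, since by [free_coordsU1] any coordinate that it separates could be
    added to it. *)
Lemma free_coords_extend A :
  free_coords W A -> exists2 B, B \in bases M & A \subset B.
Proof.
move=> fA; have PA : `[< free_coords W A >] by apply/asboolP.
have [B /maxsetP[/asboolP fB maxB] sAB] :=
  @maxset_exists _ (fun D => `[< free_coords W D >]) _ PA.
exists B => //; apply/rep; split=> // i sep.
have iB := separates_notin sep.
have := maxB (i |: B) _ (subsetUr _ _) => e.
by move: iB; rewrite -e ?setU11 //; apply/asboolP/free_coordsU1.
Qed.

Lemma indep_free A : reflect (free_coords W A) (indep M A).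
Proof.
apply: (iffP exists_inP) => [[B /rep[fB _] sAB]|/free_coords_extend//].
exact: free_coords_sub fB.
Qed.

Lemma rank_max A : exists2 B, B \in bases M & rank M A = #|A :&: B|.
Proof.
have : (0 < #|bases M|)%N by rewrite card_gt0 bases_neq0.
by case/(eq_bigmax_cond (fun B => #|A :&: B|)) => B bB rB; exists B.
Qed.

Lemma leq_rank_free A B :
  free_coords W B -> B \subset A -> (#|B| <= rank M A)%N.
Proof.
case/free_coords_extend=> C bC sBC sBA.
apply: (bigmax_sup C) => //; apply: subset_leq_card.
by rewrite subsetI sBA.
Qed.

Lemma flatP F : flat M F <-> forall i, i \notin F -> separates W F i.
Proof.
split=> [/forallP fl i iF|sep].
  have := fl i; rewrite iF /=.
  have [B bB ->] := rank_max (i |: F) => lt.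
  have [fB sB] := (rep B).1 bB.
  have fFB : free_coords W (F :&: B) by apply: free_coords_sub fB; apply: subsetIr.
  have le := leq_rank_free fFB (subsetIl _ _).
  have iB : i \in B.
    apply: contraLR lt => iB; rewrite -leqNgt; apply: leq_trans le.
    apply/subset_leq_card/subsetP => j; rewrite !inE => /andP[/predU1P[->|->]//].
    by rewrite (negPf iB).
  have [w [wW wB wi]] := fB _ iB.
  (* If [w] were nonzero at [j] in [F], then [j |: (F :&: B)] would be a free subset of [F] at least
     as large as [(i |: F) :&: B], and the rank could not grow. *)
  exists w; split=> // j jF; apply/eqP; apply: contraTT lt => wj.
  have sepj : separates W (F :&: B) j.
    exists w; split=> // l; rewrite inE => /andP[lF lB].
    apply: wB; rewrite !inE lB andbT.
    by apply: contraNneq iF => <-.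
  rewrite -leqNgt; apply: leq_trans (leq_rank_free (free_coordsU1 fFB sepj) _).
    rewrite cardsU1 (separates_notin sepj) setIUl; apply: leq_trans (leq_card_setU _ _) _.
    by rewrite leq_add2r (leq_trans (subset_leq_card (subsetIl _ _))) ?cards1.
  by rewrite subUset sub1set jF subsetIl.
apply/forallP => i; apply/implyP => iF.
have [B bB ->] := rank_max F.
have [fB sB] := (rep B).1 bB.
have fFB : free_coords W (F :&: B) by apply: free_coords_sub fB; apply: subsetIr.
have sepi := separatesS (subsetIl F B) (sep _ iF).
apply: leq_trans (leq_rank_free (free_coordsU1 fFB sepi) _).
  by rewrite cardsU1 (separates_notin sepi).
by apply: setUS; apply: subsetIl.
Qed.

(** A vector of [orth W] supported in [A] is a linear relation among the coordinate forms on [W]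
    indexed by [A]. *)
Lemma dependentP A :
  ~~ indep M A <-> exists2 w, w \in orth W & w != 0 /\ forall i, i \notin A -> w 0 i = 0.
Proof.
split=> [/indep_free|[w wO [/rV0Pn[i wi] wA]]].
  move/free_coords_orth => ns.
  have [i [w [wO wA wi]]] : exists i, separates (orth W) (~: A) i.
    by apply: contra_notP ns => h i si; apply: h; exists i.
  exists w => //; split=> [|j jA]; last by rewrite wA // inE.
  by apply: contraNneq wi => ->; rewrite mxE.
apply/indep_free => /free_coords_orth/(_ i); apply; exists w; split=> // j.
by rewrite inE => /wA.
Qed.

(* A relation involving i of minimal support is supported on a circuit. *)
Lemma circuit_cover A :
  (exists P : {set {set 'I_n}}, [forall C in P, circuit M C] && (A == cover P)) <->
  forall i, i \in A -> separates (orth W) (~: A) i.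
Proof.
split=> [[P /andP[/forall_inP cP /eqP->] i /bigcupP[C CP iC]]|sep].
  have /minsetP[dC minC] := cP _ CP.
  have [w wO [w0 wC]] := (dependentP C).1 dC.
  pose D := [set j | w 0 j != 0].
  have DC : D = C.
    apply: minC; last by apply/subsetP => j; rewrite inE; apply: contraR => /wC->.
    apply/dependentP; exists w => //; split=> // j.
    by rewrite inE negbK => /eqP.
  exists w; split=> // [j|]; last by move: iC; rewrite -DC inE.
  rewrite inE => jP; apply: wC; apply: contra jP => jC.
  by apply/bigcupP; exists C.
exists [set C | circuit M C & C \subset A].
apply/andP; split; first by apply/forall_inP => C; rewrite inE => /andP[].
apply/eqP/setP => i; apply/idP/bigcupP => [iA|[C]]; last first.
  by rewrite inE => /andP[_ /subsetP sC] /sC.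
pose Q := fun D : {set 'I_n} => `[< separates (orth W) (~: D) i >].
have QA : Q A by apply/asboolP/sep.
have [C /minsetP[/asboolP sepC minC] sCA] := minset_exists QA.
have iC : i \in C by have := separates_notin sepC; rewrite inE negbK.
exists C => //; rewrite inE sCA andbT; apply/minsetP; split.
  apply/dependentP; have [w [wO wC wi]] := sepC.
  exists w => //; split=> [|j jC]; last by rewrite wC // inE.
  by apply: contraNneq wi => ->; rewrite mxE.
move=> D /dependentP[v vO [/rV0Pn[e ve] vD]] sDC.
have eD : e \in D by apply: contraR ve => /vD->.
have [iv|vi] := eqVneq (v 0 i) 0; last first.
  apply: minC => //; apply/asboolP; exists v; split=> // j.
  by rewrite inE => /vD.
have [w [wO wC wi]] := sepC.
(* As [v] vanishes at [i] but not at [e], it can be used to remove [e] from the support of [w] while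
   keeping [i], against the minimality of [C]. *)
have : C :\ e = C.
  apply: minC; last exact: subsetDl.
  apply/asboolP; exists (w - (w 0 e / v 0 e) *: v); split.
  - by rewrite rpredB ?rpredZ.
  - move=> j; rewrite !inE negb_and negbK => /orP[/eqP->|jC].
      by rewrite !mxE divfK // subrr.
    have jD : j \notin D by apply: contra jC => /(subsetP sDC).
    by rewrite !mxE (wC j) ?inE // (vD j jD) mulr0 subr0.
  - by rewrite !mxE iv mulr0 subr0.
by move/setP/(_ e); rewrite !inE eqxx (subsetP sDC).
Qed.

Lemma cyclic_flatP F :
  cyclic_flat M F <-> flat M F /\ forall i, i \in F -> separates (orth W) (~: F) i.
Proof.
rewrite -circuit_cover.
by split=> [/andP[-> /existsP]//|[fF /existsP cF]]; apply/andP.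
Qed.

End Matroids.

From mathcomp Require Import classical_sets mpoly.

Import Order.TTheory.

(** * Ideals and primary decomposition *)

Section Ideals.
Local Open Scope ring_scope.
Local Open Scope classical_set_scope.
Variable A : comNzRingType.
Implicit Types (I J P Q : set A).

(* Unlike [idealr_closed], this allows the unit ideal. *)
Definition is_ideal I : Prop :=
  [/\ I 0, forall x y, I x -> I y -> I (x + y) & forall a x, I x -> I (a * x)].

Lemma idealr_closedE I : idealr_closed (mem I) <-> is_ideal I /\ ~ I 1.
Proof.
have E x : (x \in mem I) = (x \in I) by [].
split=> [[I0 I1 IM]|[[I0 ID IM] I1]].
  split; last by move=> h; move/negP: I1; apply; rewrite E in_setE.
  have I0' : I 0 by move: I0; rewrite E in_setE.
  split=> // [x y|a x] Ix.
    by move=> Iy; have := IM 1 x y; rewrite !E !in_setE mul1r; apply.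
  by have := IM a x 0; rewrite !E !in_setE addr0; apply.
split; first by rewrite E in_setE.
  by apply/negP; rewrite E in_setE.
by move=> a x y; rewrite !E !in_setE => Ix Iy; apply/ID => //; apply: IM.
Qed.

Lemma prime_idealE P :
  prime_ideal P <->
  [/\ is_ideal P, ~ P 1 & forall x y, P (x * y) -> P x \/ P y].
Proof.
rewrite /prime_ideal idealr_closedE.
have E x : (x \in mem P) = (x \in P) by [].
split=> [[[iP P1] pP]|[iP P1 pP]]; split=> // x y.
  by have := pP x y; rewrite !E !in_setE => h /h /orP[]; rewrite in_setE; tauto.
by rewrite !E in_setE => /pP[]; rewrite -in_setE => ->; rewrite ?orbT.
Qed.

Lemma ideal_opp I x : is_ideal I -> I x -> I (- x).
Proof. by case=> _ _ IM /(IM (-1)); rewrite mulN1r. Qed.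

Lemma ideal_sub I x y : is_ideal I -> I x -> I y -> I (x - y).
Proof. by move=> iI Ix /(ideal_opp iI); case: iI => _ ID _; apply: ID. Qed.

Lemma ideal_subK I x y : is_ideal I -> I (x - y) -> I y -> I x.
Proof. by move=> [_ ID _] Ixy Iy; rewrite -(subrK y x); apply: ID. Qed.

Lemma ideal_mulr I x y : is_ideal I -> I x -> I (x * y).
Proof. by move=> [_ _ IM] Ix; rewrite mulrC; apply: IM. Qed.

Lemma ideal_bigsum I (T : Type) (r : seq T) (p : pred T) (F : T -> A) :
  is_ideal I -> (forall i, p i -> I (F i)) -> I (\sum_(i <- r | p i) F i).
Proof. by move=> [I0 ID _] IF; apply: big_ind. Qed.

Lemma ideal_1 I : is_ideal I -> I 1 -> forall x, I x.
Proof. by move=> iI I1 x; rewrite -(mul1r x); apply: ideal_mulr. Qed.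

Lemma prime_exp P x m : prime_ideal P -> P (x ^+ m) -> P x.
Proof.
case/prime_idealE=> _ P1 pP; elim: m => [/P1//|m IH].
by rewrite exprS => /pP[|/IH].
Qed.

Lemma prime_prod P (T : Type) (r : seq T) (p : pred T) (F : T -> A) :
  prime_ideal P -> (forall i, p i -> ~ P (F i)) -> ~ P (\prod_(i <- r | p i) F i).
Proof.
case/prime_idealE=> _ P1 pP nF; apply: (big_ind (fun x => ~ P x)) => // x y nx ny /pP.
by tauto.
Qed.

Lemma generated_is_ideal (T : finType) (D : {set T}) (h : T -> A) :
  is_ideal (generated_ideal D h).
Proof.
split.
- by exists (fun=> 0); rewrite big1 // => i _; rewrite mul0r.
- move=> x y [c ->] [d ->]; exists (fun i => c i + d i).
  by rewrite -big_split; apply: eq_bigr => i _; rewrite mulrDl.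
- move=> a x [c ->]; exists (fun i => a * c i).
  by rewrite mulr_sumr; apply: eq_bigr => i _; rewrite mulrA.
Qed.

Lemma generated_mem (T : finType) (D : {set T}) (h : T -> A) i :
  i \in D -> generated_ideal D h (h i).
Proof.
move=> iD; exists (fun j => (j == i)%:R).
rewrite (bigD1 i) //= eqxx mul1r big1 ?addr0 // => j /andP[_ /negPf->].
by rewrite mul0r.
Qed.

Lemma generated_sub (T : finType) (D : {set T}) (h : T -> A) I :
  is_ideal I -> (forall i, i \in D -> I (h i)) -> generated_ideal D h `<=` I.
Proof.
move=> iI hI x [c ->]; apply: ideal_bigsum => // i iD.
by case: iI => _ _; apply; apply: hI.
Qed.

Lemma ideal_sum_is_ideal I J : is_ideal I -> is_ideal J -> is_ideal (ideal_sum I J).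
Proof.
move=> [I0 ID IM] [J0 JD JM]; split.
- by exists 0, 0; rewrite addr0.
- move=> _ _ [x [y [Ix Jy ->]]] [x' [y' [Ix' Jy' ->]]].
  by exists (x + x'), (y + y'); rewrite addrACA; split; [apply: ID|apply: JD|].
- move=> a _ [x [y [Ix Jy ->]]].
  by exists (a * x), (a * y); rewrite mulrDr; split; [apply: IM|apply: JM|].
Qed.

Lemma ideal_sum_subl I J : is_ideal J -> I `<=` ideal_sum I J.
Proof. by move=> [J0 _ _] x Ix; exists x, 0; rewrite addr0. Qed.

Lemma ideal_sum_subr I J : is_ideal I -> J `<=` ideal_sum I J.
Proof. by move=> [I0 _ _] x Jx; exists 0, x; rewrite add0r. Qed.

Lemma ideal_sum_sub I J P : is_ideal P ->
  I `<=` P -> J `<=` P -> ideal_sum I J `<=` P.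
Proof. by move=> [_ PD _] sI sJ _ [x [y [/sI Px /sJ Py ->]]]; apply: PD. Qed.

Lemma principal_is_ideal x : is_ideal [set z | exists r, z = r * x].
Proof.
split; first by exists 0; rewrite mul0r.
  by move=> _ _ [r ->] [s ->]; exists (r + s); rewrite mulrDl.
by move=> a _ [r ->]; exists (a * r); rewrite mulrA.
Qed.

Lemma colon_is_ideal I x : is_ideal I -> is_ideal [set z | I (z * x)].
Proof.
move=> [I0 ID IM]; split; rewrite /= ?mul0r //.
  by move=> y z Iy Iz; rewrite mulrDl; apply: ID.
by move=> a z Iz; rewrite -mulrA; apply: IM.
Qed.

Definition noetherian : Prop :=
  forall I : nat -> set A, (forall i, is_ideal (I i)) ->
    (forall i, I i `<=` I i.+1) -> exists i, I i.+1 `<=` I i.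

(** An ideal violating [K] lies strictly inside another such ideal; iterating this choice builds a
    strictly increasing chain. *)
Lemma noetherian_ind (H : noetherian) (K : set A -> Prop) :
  (forall I, is_ideal I ->
     (forall J, is_ideal J -> I `<=` J -> ~ (J `<=` I) -> K J) -> K I) ->
  forall I, is_ideal I -> K I.
Proof.
move=> step I iI; apply: contrapT => nK.
pose T := {J : set A | is_ideal J /\ ~ K J}.
have /choice[f fP] (J : T) : exists J' : T,
    sval J `<=` sval J' /\ ~ (sval J' `<=` sval J).
  case: J => J [iJ nJ] /=; apply: contrapT => no.
  apply/nJ/step => // J' iJ' sJ nsJ; apply: contrapT => nJ'.
  by apply: no; exists (exist _ J' (conj iJ' nJ')).
pose u i := sval (iter i f (exist _ I (conj iI nK))).
have [i|i|i] := H u; first by case: (svalP (iter i f (exist _ I (conj iI nK)))).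
  by case: (fP (iter i f (exist _ I (conj iI nK)))).
by case: (fP (iter i f (exist _ I (conj iI nK)))).
Qed.

Definition primary_decomposition I m (q : 'I_m -> set A) :=
  (forall j, primary_ideal (q j)) /\ forall x, I x <-> forall j, q j x.

Lemma primary_decomposition_cap I J K m1 m2 (q1 : 'I_m1 -> set A) (q2 : 'I_m2 -> set A) :
  primary_decomposition I q1 -> primary_decomposition J q2 ->
  (forall x, K x <-> I x /\ J x) ->
  exists m (q : 'I_m -> set A), primary_decomposition K q.
Proof.
move=> [p1 e1] [p2 e2] KE; exists (m1 + m2)%N.
exists (fun j => match split j with inl a => q1 a | inr b => q2 b end); split.
  by move=> j; case: (split j).
move=> x; rewrite KE e1 e2; split=> [[h1 h2] j|h]; first by case: (split j).
split=> j; first by have := h (unsplit (inl j)); rewrite unsplitK.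
by have := h (unsplit (inr j)); rewrite unsplitK.
Qed.

(* In the inductive step, x y \in I with x \notin I and y^m \notin I, and
   I = (I + (x)) \cap (I + (y^m)) as soon as (I : y^m) = (I : y^(m+1)). *)
Lemma lasker_noether (H : noetherian) I : is_ideal I ->
  exists m (q : 'I_m -> set A), primary_decomposition I q.
Proof.
move: I; apply: (noetherian_ind H) => I iI IH.
have [I1|I1] := pselect (I 1).
  (* The unit ideal is the empty intersection. *)
  exists 0%N, (fun=> I); split=> [[]//|x].
  by split=> _; [case|apply: ideal_1].
have [pI|npI] := pselect (primary_ideal I).
  by exists 1%N, (fun=> I); split=> // x; split=> [//|]; apply; apply: ord0.
have [x [y [Ixy nx ny]]] : exists x y, [/\ I (x * y), ~ I x & ~ radical I y].
  apply: contrapT => no; apply: npI; split; first exact/idealr_closedE.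
  move=> x y Ixy; apply: contrapT => /not_orP[nx ny].
  by apply: no; exists x, y.
have [|i z|m stab] := H (fun m => [set z | I (z * y ^+ m)]).
- by move=> m; apply: colon_is_ideal.
- by rewrite /= exprSr mulrA; apply: ideal_mulr.
have ex t : I `<=` ideal_sum I [set z | exists r, z = r * t].
  exact/ideal_sum_subl/principal_is_ideal.
have mem t : ideal_sum I [set z | exists r, z = r * t] t.
  by apply: ideal_sum_subr => //; exists 1; rewrite mul1r.
have dec t : ~ I t -> exists m (q : 'I_m -> set A),
    primary_decomposition (ideal_sum I [set z | exists r, z = r * t]) q.
  move=> nt; apply: IH; first exact/ideal_sum_is_ideal/principal_is_ideal.
    exact: ex.
  by move=> /(_ _ (mem t)).
have [m1 [q1 d1]] := dec x nx.
have [|m2 [q2 d2]] := dec (y ^+ m); first by move=> ?; apply: ny; exists m.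
apply: (primary_decomposition_cap d1 d2) => z; split=> [Iz|].
  by split; apply: ex.
case=> [[a [_ [Ia [r ->] ->]]] [b [_ [Ib [s ->] zE]]]].
(* Here [z] is both [a + r * x] and [b + s * y ^+ m]. Since [x * y] is in [I], so are [z * y] and
   hence [s * y ^+ m.+1]; stability of the colon ideals then puts [s * y ^+ m] in [I]. *)
have Iz : I ((a + r * x) * y).
  rewrite mulrDl; case: (iI) => _ ID IM; apply: ID; first exact: ideal_mulr.
  by rewrite -mulrA; apply: IM.
have Is : I (s * y ^+ m).
  apply: stab; rewrite /= exprSr mulrA.
  have -> : s * y ^+ m * y = (a + r * x) * y - b * y.
    by rewrite zE mulrDl addrAC subrr add0r.
  by apply: ideal_sub => //; apply: ideal_mulr.
by rewrite zE; case: (iI) => _ ID _; apply: ID.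
Qed.

Lemma radical_primary_exp Q x m : is_ideal Q -> Q (x ^+ m) ->
  forall l, (m <= l)%N -> Q (x ^+ l).
Proof. by move=> iQ Qx l le; rewrite -(subnKC le) exprD; apply: ideal_mulr. Qed.

Lemma primary_cap Q1 Q2 : primary_ideal Q1 -> primary_ideal Q2 ->
  radical Q1 = radical Q2 -> primary_ideal (Q1 `&` Q2).
Proof.
move=> [/idealr_closedE[i1 n1] p1] [/idealr_closedE[i2 n2] p2] e; split.
  apply/idealr_closedE; split; last by case.
  case: i1 i2 => a1 a2 a3 [b1 b2 b3]; split=> // [x y [? ?] [? ?]|a x [? ?]].
    by split; [apply: a2|apply: b2].
  by split; [apply: a3|apply: b3].
move=> x y [/p1 h1 /p2 h2].
have [ry|nry] := pselect (radical Q1 y); last first.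
  by left; split; [case: h1|move: nry; rewrite e; case: h2].
right; have [m1 y1] := ry; have [m2 y2] : radical Q2 y by rewrite -e.
exists (maxn m1 m2); split.
  exact: (radical_primary_exp i1 y1 (leq_maxl _ _)).
exact: (radical_primary_exp i2 y2 (leq_maxr _ _)).
Qed.

(** A decomposition of least length is minimal: two components with the same radical could be
    intersected, and a redundant one dropped. *)
Lemma minimal_primary_decomposition_exists (H : noetherian) I : is_ideal I ->
  exists m (q : 'I_m -> set A), minimal_primary_decomposition I q.
Proof.
move=> /(lasker_noether H) ex.
have ex' : exists m, `[< exists q : 'I_m -> set A, primary_decomposition I q >].
  by have [m ?] := ex; exists m; apply/asboolP.
case: (ex_minnP ex') => m /asboolP[q [pq qE]] min_m; exists m, q.
have smaller m' (q' : 'I_m' -> set A) : primary_decomposition I q' -> ~ (m' < m)%N.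
  move=> d' lt; suff : (m <= m')%N by rewrite leqNgt lt.
  by apply: min_m; apply/asboolP; exists q'.
split=> //.
- by apply/seteqP; split=> [x /qE h j _|x h]; [|apply/qE => j]; apply: h.
- move=> i j rij; apply/eqP; apply: contraT => ij.
  case: m q pq qE min_m smaller i j rij ij => [|m] q pq qE _ smaller i j rij ij.
    by case: i rij ij.
  case: (smaller m (fun l => if lift j l == i then q i `&` q j else q (lift j l))) => //.
  split=> [l|x]; first by case: ifP => // _; apply: primary_cap.
  rewrite qE; split=> h l; first by case: ifP.
  have ji : j != i by rewrite eq_sym.
  have [i' iE _] := unlift_some ji.
  have [l' ->|->] := unliftP j l.
    by have := h l'; case: eqP => [->[]|].
  by have := h i'; rewrite -iE eqxx => -[].
- move=> j red.
  case: m q pq qE min_m smaller j red => [|m] q pq qE _ smaller j red; first by case: j red.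
  case: (smaller m (fun l => q (lift j l))) => //; split=> // x; rewrite qE.
  split=> h l; first exact: h.
  have hj i : i != j -> q i x.
    by rewrite eq_sym => /unlift_some[i' -> _].
  by have [->|/hj//] := eqVneq l j; apply: red => i /=; apply: hj.
Qed.

(* The element u witnesses that I and P agree after localizing at P. *)
Lemma primary_component_prime (H : noetherian) I P u :
  is_ideal I -> prime_ideal P -> I `<=` P -> ~ P u -> (forall x, P x -> I (x * u)) ->
  forall Q, primary_component I P Q <-> Q = P.
Proof.
move=> iI pP sIP nu uP Q; have [iP P1 PM] := (prime_idealE P).1 pP.
(* For [x] in [P] the product [x * u] is in [q j]; if no power of [u] is, primariness leaves [x] in
   [q j]. *)
have sub m (q : 'I_m -> set A) j : minimal_primary_decomposition I q ->
    (forall m, ~ q j (u ^+ m)) -> P `<=` q j.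
  move=> [pq IE _ _] nq x /uP Ixu.
  have : q j (x * u) by move: Ixu; rewrite IE; apply.
  by case/(pq j).2 => // -[l /nq].
split=> [[m [q [mq [j [<- rj]]]]]|->].
  apply/seteqP; split=> x; first by rewrite -rj => qx; exists 1%N; rewrite expr1.
  by apply: sub mq _ _ => l ql; apply: nu; rewrite -rj; exists l.
have [m [q mq]] := minimal_primary_decomposition_exists H iI.
exists m, q; split=> //; have [pq IE _ _] := mq.
(* Otherwise each [q j] has an element outside [P], and the product of these lies in [I] but not in
   the prime [P]. *)
have [j qP] : exists j, q j `<=` P.
  apply: contrapT => no.
  have /choice[x xP] j : exists x, q j x /\ ~ P x.
    apply: contrapT => nx; apply: no; exists j => x qx.
    by apply: contrapT => nPx; apply: nx; exists x.
  apply: (@prime_prod P _ (index_enum 'I_m) predT x pP); first by move=> j _; case: (xP j).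
  apply: sIP; rewrite IE => j _; rewrite (bigD1 j) //=.
  by apply: ideal_mulr; [case/idealr_closedE: (pq j).1|case: (xP j)].
have qE : q j = P.
  apply/seteqP; split=> //; apply: sub mq _ => l /qP.
  by move/(prime_exp pP).
exists j; rewrite qE; split=> //; apply/seteqP; split=> [x [l]|x Px].
  exact: prime_exp.
by exists 1%N; rewrite expr1.
Qed.

End Ideals.

(** * Dickson's lemma and Hilbert's basis theorem *)

Section HilbertBasis.
Local Open Scope ring_scope.
Local Open Scope classical_set_scope.

(** Pick repeatedly an index at which [v] attains its minimum over the remaining tail. *)
Lemma nat_monotone_subsequence (v : nat -> nat) :
  exists p : nat -> nat, (forall i, p i < p i.+1)%N /\
    forall i j, (i <= j)%N -> (v (p i) <= v (p j))%N.
Proof.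
have /choice[p pP] i : exists j, (i <= j)%N /\ forall l, (i <= l)%N -> (v j <= v l)%N.
  have ex : exists m, `[< exists2 j, (i <= j)%N & v j = m >].
    by exists (v i); apply/asboolP; exists i.
  case: (ex_minnP ex) => m /asboolP[j ij <-] min; exists j; split=> // l il.
  by apply: min; apply/asboolP; exists l.
pose q := fix q i := if i is i'.+1 then p (q i').+1 else p 0%N.
have qS i : (q i < q i.+1)%N by case: (pP (q i).+1).
have vq i l : (q i <= l)%N -> (v (q i) <= v l)%N.
  by case: i => [|i] /= le; apply: (pP _).2 => //; apply: leq_trans le;
    case: (pP (q i).+1).
exists q; split=> // i j ij; apply: vq.
elim: j ij => [|j IH]; rewrite leq_eqVlt => /predU1P[->//|] //= /IH le.
exact/ltnW/(leq_ltn_trans le).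
Qed.

(** Successive subsequences make the exponents monotone in one variable after another. *)
Lemma dickson n (u : nat -> 'X_{1..n}) : exists i j, (i < j)%N /\ (u i <= u j)%MM.
Proof.
suff [p [pS pm]] : exists p : nat -> nat, (forall i, p i < p i.+1)%N /\
    forall a i j, a \in enum 'I_n -> (i <= j)%N -> (u (p i) a <= u (p j) a)%N.
  exists (p 0%N), (p 1%N); split=> //; apply/mnm_lepP => a.
  by apply: pm; rewrite ?mem_enum.
elim: (enum 'I_n) => [|a s [p [pS pm]]].
  by exists id; split.
have [q [qS qm]] := nat_monotone_subsequence (fun i => u (p i) a).
have mono (r : nat -> nat) : (forall i, r i < r i.+1)%N ->
    forall i j, (i <= j)%N -> (r i <= r j)%N.
  move=> rS i; elim=> [|j IH]; rewrite leq_eqVlt => /predU1P[->//|] //= /IH le.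
  exact/ltnW/(leq_ltn_trans le).
have smono (r : nat -> nat) : (forall i, r i < r i.+1)%N ->
    forall i j, (i < j)%N -> (r i < r j)%N.
  by move=> rS i j ij; apply: leq_trans (rS i) _; apply: mono.
exists (p \o q); split=> [i|b i j] /=; first exact: smono.
rewrite inE => /predU1P[->|bs] ij; first exact: qm.
by apply: pm => //; apply: mono.
Qed.

(* Along a strictly increasing chain pick x_i \in I_(i+1) \ I_i of least leading
   monomial; by Dickson's lemma some x_i cancels the leading term of a later x_j. *)
Lemma mpoly_noetherian (k : fieldType) n : noetherian {mpoly k[n]}.
Proof.
move=> I iI sI; apply: contrapT => no.
have sIm i j : (i <= j)%N -> I i `<=` I j.
  elim: j => [|j IH]; rewrite leq_eqVlt => /predU1P[->//|] //= /IH le.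
  exact: subset_trans (sI j).
have /choice[x xP] i : exists x, [/\ I i.+1 x, ~ I i x &
    forall y, I i.+1 y -> ~ I i y -> (mlead x <= mlead y)%O].
  have [x0 [Ix0 nx0]] : exists x, I i.+1 x /\ ~ I i x.
    apply: contrapT => nx; apply: no; exists i => x Ix; apply: contrapT => nIx.
    by apply: nx; exists x.
  have [m mE] : exists m, m = mlead x0 by exists (mlead x0).
  elim/(well_founded_ind (@ltom_wf n)): m x0 Ix0 nx0 mE => m IH x0 Ix0 nx0 mE.
  have [[y [Iy ny lt]]|ny] :=
    pselect (exists y, [/\ I i.+1 y, ~ I i y & (mlead y < mlead x0)%O]).
    by apply: (IH (mlead y)) Iy ny _ => //; rewrite mE.
  exists x0; split=> // y Iy nIy; rewrite leNgt; apply/negP => lt.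
  by apply: ny; exists y.
have [i [j [ij le]]] := dickson (fun i => mlead (x i)).
have [Ixi nxi _] := xP i; have [Ixj nxj minj] := xP j.
have x0 l : x l != 0.
  by apply/eqP => x0; case: (xP l); rewrite x0 => _; case: (iI l).
pose c := mleadc (x j) / mleadc (x i).
pose z := c *: (x i * 'X_[mlead (x j) - mlead (x i)]).
have Iz : I j z.
  rewrite /z -mul_mpolyC; apply: (sIm _ _ ij); case: (iI i.+1) => _ _; apply.
  exact: ideal_mulr.
have Iy : I j.+1 (x j - z) by apply: ideal_sub => //; apply: sI.
have ny : ~ I j (x j - z) by move=> h; apply/nxj/(ideal_subK (iI j) h).
have zE : z@_(mlead (x j)) = mleadc (x j).
  have := mcoeffMX (x i) (mlead (x j) - mlead (x i)) (mlead (x i)).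
  by rewrite submK // mcoeffZ => ->; rewrite divfK // mleadc_eq0.
have zle : (mlead z <= mlead (x j))%O.
  apply: le_trans (mleadZ_le _ _) _; apply: le_trans (mleadM_le _ _) _.
  by rewrite mleadXm addmC submK.
have yle : (mlead (x j - z) <= mlead (x j))%O.
  by apply: le_trans (mleadB_le _ _) _; rewrite leUx lexx.
(* Minimality of [x j] forces this equality, yet [z] cancels that very term; hence [x j - z] is zero
   and lies in [I j] after all. *)
have yE : mlead (x j - z) = mlead (x j).
  by apply/le_anti; rewrite yle minj.
have : x j - z == 0 by rewrite -mleadc_eq0 yE mcoeffB zE subrr.
by move=> /eqP y0; apply: ny; rewrite y0; case: (iI j).
Qed.

End HilbertBasis.

(** * Polynomials along a subspace of linear forms *)

Section LinearForms.
Local Open Scope ring_scope.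
Local Open Scope classical_set_scope.
Variables (k : fieldType) (N : nat).
Local Notation S := {mpoly k[N]}.
Implicit Types (v : 'rV[k]_N) (b : set S).

(** The polynomials on which [phi] and [psi] agree modulo [I] are closed under sums and products. *)
Lemma rmorph_mpoly_eq_mod (T : comNzRingType) (phi psi : {rmorphism S -> T}) (I : set T) :
  is_ideal I -> (forall c, phi c%:MP = psi c%:MP) ->
  (forall j, I (phi 'X_j - psi 'X_j)) -> forall p, I (phi p - psi p).
Proof.
move=> iI hC hX; case: (iI) => I0 ID IM.
pose K p := I (phi p - psi p).
have K1 : K 1 by rewrite /K !rmorph1 subrr.
have KM p q : K p -> K q -> K (p * q).
  rewrite /K => Kp Kq; rewrite !rmorphM.
  have -> : phi p * phi q - psi p * psi q =
      phi p * (phi q - psi q) + psi q * (phi p - psi p).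
    by rewrite !mulrBr addrA [psi q * _]mulrC subrK [psi q * _]mulrC.
  by apply: ID; apply: IM.
elim/mpolyind => [|c m p _ _ Kp]; first by rewrite !rmorph0 subrr.
rewrite !rmorphD opprD addrACA; apply: (ID) => //.
rewrite -mul_mpolyC; apply: (KM) => //; first by rewrite /K hC subrr.
rewrite mpolyXE_id; apply: (big_ind K) => // i _.
elim: (m i) => [|l IH] //; rewrite exprS; apply: (KM) => //; exact: hX.
Qed.

Lemma rmorph_mpoly_eq (T : comNzRingType) (phi psi : {rmorphism S -> T}) :
  (forall c, phi c%:MP = psi c%:MP) -> (forall j, phi 'X_j = psi 'X_j) -> phi =1 psi.
Proof.
move=> hC hX p; apply/eqP; rewrite -subr_eq0; apply/eqP.
apply: (@rmorph_mpoly_eq_mod T phi psi [set 0]) => //; last by move=> j; rewrite hX subrr.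
by split=> //= [x y -> ->|a x ->]; rewrite ?addr0 ?mulr0.
Qed.

Definition lin v : S := \sum_j v 0 j *: 'X_j.

Fact lin_is_linear : linear lin.
Proof.
move=> c u v; rewrite /lin scaler_sumr -big_split; apply: eq_bigr => j _.
by rewrite !mxE scalerDl scalerA.
Qed.
HB.instance Definition _ := GRing.isLinear.Build k 'rV[k]_N S *:%R lin lin_is_linear.

Lemma ideal_lin_span I (s : seq 'rV[k]_N) v : is_ideal I ->
  v \in <<s>>%VS -> (forall t, t \in s -> I (lin t)) -> I (lin v).
Proof.
move=> iI vs sI; rewrite (@coord_span _ _ _ (in_tuple s) v) // linear_sum.
apply: ideal_bigsum => // i _; rewrite linearZ /= -mul_mpolyC.
by case: iI => _ _; apply; apply/sI/mem_nth.
Qed.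

Variable Y : {vspace 'rV[k]_N}.

Definition coproj : 'End('rV[k]_N) := (\1 - projv Y)%VF.

Lemma coprojE v : coproj v = v - projv Y v.
Proof. by rewrite add_lfunE opp_lfunE id_lfunE. Qed.

Lemma coproj_id v : v \in Y -> coproj v = 0.
Proof. by move=> vY; rewrite coprojE projv_id // subrr. Qed.

Lemma coprojK v : coproj (coproj v) = coproj v.
Proof.
by rewrite [coproj v]coprojE linearB /= (coproj_id (memv_proj _ _)) subr0 coprojE.
Qed.

(* A retraction whose kernel is the ideal generated by Y. *)
Definition retract : S -> S :=
  mmap (@mpolyC N k) (fun j => lin (coproj (delta_mx 0 j))).
HB.instance Definition _ := GRing.RMorphism.on retract.

Lemma retractC c : retract c%:MP = c%:MP. Proof. exact: mmapC. Qed.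

Lemma retract_lin v : retract (lin v) = lin (coproj v).
Proof.
rewrite {2}(row_sum_delta v) !linear_sum raddf_sum; apply: eq_bigr => j _.
by rewrite !linearZ /= /retract mmapZ mmapX mmap1U mul_mpolyC.
Qed.

Lemma lin_delta j : lin (delta_mx 0 j) = 'X_j.
Proof.
rewrite /lin (bigD1 j) //= mxE !eqxx scale1r big1 ?addr0 // => l lj.
by rewrite mxE (negPf lj) andbF scale0r.
Qed.

Lemma retractX j : retract 'X_j = lin (coproj (delta_mx 0 j)).
Proof. by rewrite -lin_delta retract_lin. Qed.

Lemma retract_mod I p : is_ideal I -> (forall v, v \in Y -> I (lin v)) ->
  I (p - retract p).
Proof.
move=> iI YI; apply: (@rmorph_mpoly_eq_mod S idfun retract I iI) => [c|j].
    by rewrite /= retractC.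
by rewrite /= retractX -lin_delta -linearB coprojE subKr; apply/YI/memv_proj.
Qed.

(* The expansion of a polynomial along a complement of Y: linear forms in Y stay
   coefficients, while those in the complement become linear forms in new variables. *)
Definition expand : S -> {mpoly S[N]} :=
  mmap (@mpolyC N S \o @mpolyC N k)
       (fun j => (lin (projv Y (delta_mx 0 j)))%:MP +
                 map_mpoly (@mpolyC N k) (lin (coproj (delta_mx 0 j)))).
HB.instance Definition _ := GRing.RMorphism.on expand.

Lemma expandC c : expand c%:MP = c%:MP%:MP. Proof. exact: mmapC. Qed.

Lemma expand_lin v :
  expand (lin v) = (lin (projv Y v))%:MP + map_mpoly (@mpolyC N k) (lin (coproj v)).
Proof.
rewrite {2 3}(row_sum_delta v) !linear_sum /= !raddf_sum -big_split.
apply: eq_bigr => j _; rewrite !linearZ /= /expand mmapZ mmapX mmap1U /= mulrDr.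
by rewrite -[in RHS]mul_mpolyC mpolyCM map_mpolyZ -mul_mpolyC.
Qed.

Lemma expand_fixed v : v \in Y -> expand (lin v) = (lin v)%:MP.
Proof. by move=> vY; rewrite expand_lin projv_id // coproj_id // linear0 raddf0 addr0. Qed.

(** A retracted polynomial involves only forms in the complement of [Y], so its expansion has scalar
    coefficients. *)
Lemma expand_retract p : expand (retract p) = map_mpoly (@mpolyC N k) (retract p).
Proof.
apply: (@rmorph_mpoly_eq _ (expand \o retract) (map_mpoly (@mpolyC N k) \o retract)).
  by move=> c; rewrite /= !retractC expandC map_mpolyC.
move=> j; rewrite /= retractX expand_lin coprojK.
by rewrite [X in projv Y X]coprojE linearB /= projv_proj subrr linear0 raddf0 add0r.
Qed.

Lemma meval_map_mpolyC (q : S) : (map_mpoly (@mpolyC N k) q).@[fun j => 'X_j] = q.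
Proof.
apply: (@rmorph_mpoly_eq _ (meval (fun j => 'X_j) \o map_mpoly (@mpolyC N k)) idfun).
  by move=> c; rewrite /= map_mpolyC mevalC.
by move=> j; rewrite /= map_mpolyX mevalXU.
Qed.

Lemma meval_expand p : (expand p).@[fun j => 'X_j] = p.
Proof.
apply: (@rmorph_mpoly_eq _ (meval (fun j => 'X_j) \o expand) idfun) => [c|j] /=.
  by rewrite expandC mevalC.
rewrite -lin_delta expand_lin mevalD mevalC meval_map_mpolyC -linearD coprojE.
by rewrite addrC subrK.
Qed.

(** The generators expand to constants, so multiplying by them acts on each coefficient
    separately. *)
Lemma expand_generated (T : finType) (t : T -> S) :
  (forall i, expand (t i) = (t i)%:MP) ->
  forall x, generated_ideal [set: T]%SET t x ->
  forall m, generated_ideal [set: T]%SET t (expand x)@_m.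
Proof.
move=> tE _ [c ->] m; rewrite rmorph_sum /= raddf_sum.
apply: (ideal_bigsum _ (generated_is_ideal _ _)) => i _.
rewrite /= rmorphM /= tE mulrC mcoeffCM.
apply: ideal_mulr; [exact: generated_is_ideal|exact: generated_mem].
Qed.

(* S / b is torsion-free over the polynomial ring on a complement of Y when b is
   generated by polynomials in Y: look at leading coefficients of [expand]. *)
Lemma retract_regular b h x : is_ideal b ->
  (forall y, b y -> forall m, b (expand y)@_m) ->
  retract h != 0 -> b (retract h * x) -> b x.
Proof.
move=> ib bE nh bhx; case: (ib) => b0 bD bM.
set H := expand (retract h).
have HE m : H@_m = ((retract h)@_m)%:MP by rewrite /H expand_retract mcoeff_map_mpoly.
have H0 : H != 0.
  by apply: contra nh => /eqP H0; rewrite -(meval_expand (retract h)) -/H H0 meval0.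
(* The leading coefficient of [H] is a nonzero scalar, hence a unit. *)
have leadH c : b (mleadc H * c) -> b c.
  set a := (retract h)@_(mlead H); have a0 : a != 0.
    by move: H0; rewrite -mleadc_eq0 HE mpolyC_eq0.
  by rewrite HE => /(bM a^-1%:MP); rewrite mulrA -mpolyCM mulVf // mul1r.
(* The leading coefficient of [X] is in [b] by [leadH]; removing the leading term keeps the
   coefficients of [H * X] in [b], so induction on the leading monomial applies. *)
have cancelH : forall X : {mpoly S[N]}, (forall m, b (H * X)@_m) -> forall m, b X@_m.
  elim/mleadrect => X IH bHX m.
  have bc : b (mleadc X) by apply: leadH; rewrite -mleadcM.
  set X' := X - mleadc X *: 'X_[mlead X].
  suff bX' : b X'@_m.
    move: bX'; rewrite mcoeffB => /(ideal_subK ib); apply.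
    by rewrite mcoeffZ; apply: ideal_mulr.
  have [->|X'0] := eqVneq X' 0; first by rewrite mcoeff0.
  have X0 : X != 0.
    by apply: contra X'0 => /eqP X0; rewrite /X' X0 mcoeff0 scale0r subr0.
  apply: IH; first exact: ltm_mleadD.
  move=> l; rewrite mulrBr -scalerAr mcoeffB mcoeffZ.
  by apply: ideal_sub => //; apply: ideal_mulr.
have bX : forall m, b (expand x)@_m.
  by apply: cancelH => m; rewrite /H -rmorphM; apply: bE.
rewrite -(meval_expand x) mevalE; apply: ideal_bigsum => // m _.
by apply: ideal_mulr.
Qed.

Lemma retract_ker_prime : prime_ideal [set p | retract p = 0].
Proof.
apply/prime_idealE; split.
- split=> /=; first by rewrite rmorph0.
    by move=> x y x0 y0; rewrite rmorphD /= x0 y0 addr0.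
  by move=> a x x0; rewrite rmorphM /= x0 mulr0.
- by rewrite /= rmorph1; apply/eqP/oner_neq0.
- by move=> x y /eqP; rewrite rmorphM mulf_eq0 => /orP[]/eqP; [left|right].
Qed.

End LinearForms.

(** * The ideal of pairs *)

Section IdealOfPairs.
Local Open Scope ring_scope.
Local Open Scope classical_set_scope.
Variables (k : fieldType) (n : nat) (W : {vspace 'rV[k]_n}).
Local Notation S := (pair_ring W).
Local Notation f := (coord_f W).
Local Notation g := (coord_g W).
Local Notation a := (ideal_of_pairs W).
Implicit Types (P : set S) (F G I J : {set 'I_n}).

Definition row_f i : 'rV[k]_(\dim W + \dim (orth W)) :=
  row_mx (\row_j (vbasis W)`_j 0 i) 0.

Definition row_g i : 'rV[k]_(\dim W + \dim (orth W)) :=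
  row_mx 0 (\row_j (vbasis (orth W))`_j 0 i).

Lemma lin_row_f i : lin (row_f i) = f i.
Proof.
rewrite /lin big_split_ord /= [X in _ + X]big1 ?addr0 => [|j _].
  by apply: eq_bigr => j _; rewrite row_mxEl mxE.
by rewrite row_mxEr mxE scale0r.
Qed.

Lemma lin_row_g i : lin (row_g i) = g i.
Proof.
rewrite /lin big_split_ord /= big1 ?add0r => [|j _].
  by apply: eq_bigr => j _; rewrite row_mxEr mxE.
by rewrite row_mxEl mxE scale0r.
Qed.

Lemma coord_f_relation w : w \in orth W -> \sum_i w 0 i *: f i = 0.
Proof.
move=> /orthP wO.
under eq_bigr => i _ do rewrite scaler_sumr.
rewrite exchange_big big1 // => j _.
under eq_bigr => i _ do rewrite scalerA mulrC.
rewrite -scaler_suml.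
have -> : \sum_i (vbasis W)`_j 0 i * w 0 i = 0.
  by apply: wO; apply/vbasis_mem/mem_nth; rewrite size_tuple.
by rewrite scale0r.
Qed.

Lemma coord_g_relation w : w \in W -> \sum_i w 0 i *: g i = 0.
Proof.
move=> wW.
under eq_bigr => i _ do rewrite scaler_sumr.
rewrite exchange_big big1 // => j _.
under eq_bigr => i _ do rewrite scalerA.
rewrite -scaler_suml.
have : (vbasis (orth W))`_j \in orth W by apply/vbasis_mem/mem_nth; rewrite size_tuple.
by move/orthP/(_ _ wW); rewrite /dot => ->; rewrite scale0r.
Qed.

(** Without separation, the Fredholm alternative gives a vector of [orth U] whose relation writes
    [h i] through the [h j] with [j] in [F], which would put it in [P]. *)
Lemma separates_of_ideal (U : {vspace 'rV[k]_n}) (h : 'I_n -> S) P F i :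
  (forall w, w \in orth U -> \sum_j w 0 j *: h j = 0) ->
  is_ideal P -> (forall j, j \in F -> P (h j)) -> ~ P (h i) -> separates U F i.
Proof.
move=> rel iP PF nPi.
have iF : i \notin F by apply/negP => /PF.
apply/(separates_orth _ iF) => -[w [wO wF wi]]; apply: nPi.
have : P (w 0 i *: h i).
  have := rel _ wO; rewrite (bigD1 i) //= => /eqP; rewrite addr_eq0 => /eqP->.
  apply: ideal_opp => //; apply: ideal_bigsum => // j ji.
  rewrite -mul_mpolyC; case: (iP) => P0 _ PM.
  have [/PF /PM//|jF] := boolP (j \in F).
  by rewrite wF ?mpolyC0 ?mul0r // !inE negb_or ji.
case: (iP) => _ _ PM /(PM (w 0 i)^-1%:MP).
by rewrite mul_mpolyC scalerA mulVf // scale1r.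
Qed.

Lemma coord_ideal_is_ideal F G : is_ideal (coord_ideal W F G).
Proof. by apply: ideal_sum_is_ideal; apply: generated_is_ideal. Qed.

Lemma coord_ideal_f F G i : i \in F -> coord_ideal W F G (f i).
Proof.
by move=> iF; apply: ideal_sum_subl; [apply: generated_is_ideal|apply: generated_mem].
Qed.

Lemma coord_ideal_g F G i : i \in G -> coord_ideal W F G (g i).
Proof.
by move=> iG; apply: ideal_sum_subr; [apply: generated_is_ideal|apply: generated_mem].
Qed.

Lemma coord_ideal_sub P F G : is_ideal P ->
  (forall i, i \in F -> P (f i)) -> (forall i, i \in G -> P (g i)) ->
  coord_ideal W F G `<=` P.
Proof. by move=> iP PF PG; apply: ideal_sum_sub => //; apply: generated_sub. Qed.

Lemma pairs_is_ideal : is_ideal a.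
Proof. exact: generated_is_ideal. Qed.

Lemma pairs_mem i : a (f i * g i).
Proof. by apply: (generated_mem (fun i => f i * g i)). Qed.

Lemma pairs_sub P : is_ideal P -> (forall i, P (f i) \/ P (g i)) -> a `<=` P.
Proof.
move=> iP Pfg; apply: generated_sub => // i _.
by case: (Pfg i) => h; [apply: ideal_mulr|case: iP => _ _; apply].
Qed.

Lemma coord_ideal_vanish F G w w' x :
  w \in W -> w' \in orth W ->
  (forall i, i \in F -> w 0 i = 0) -> (forall i, i \in G -> w' 0 i = 0) ->
  coord_ideal W F G x -> x.@[pair_point w w'] = 0.
Proof.
move=> wW wO wF wG.
have iK : is_ideal [set x : S | x.@[pair_point w w'] = 0].
  split=> /=; first by rewrite meval0.
    by move=> y z y0 z0; rewrite mevalD y0 z0 addr0.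
  by move=> y z z0; rewrite mevalM z0 mulr0.
by apply: (coord_ideal_sub iK) => i iF /=; rewrite ?coord_fE ?coord_gE; auto.
Qed.

(** At the point [(w, 0)], with [w] the separating vector, the ideal vanishes and [f i] does not. *)
Lemma coord_ideal_fE F G i : separates W F i -> ~ coord_ideal W F G (f i).
Proof.
move=> [w [wW wF wi]] /(coord_ideal_vanish wW (mem0v (orth W)) wF) h.
by move: wi; rewrite -(coord_fE i 0 wW) h ?eqxx // => j _; rewrite mxE.
Qed.

Lemma coord_ideal_gE F G i : separates (orth W) G i -> ~ coord_ideal W F G (g i).
Proof.
move=> [w [wO wG wi]] h.
have := coord_ideal_vanish (mem0v W) wO _ wG h; rewrite coord_gE // => wi0.
by move: wi; rewrite wi0 ?eqxx // => j _; rewrite mxE.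
Qed.

Definition coord_span I J : {vspace 'rV[k]_(\dim W + \dim (orth W))} :=
  <<[seq row_f i | i <- enum I] ++ [seq row_g i | i <- enum J]>>%VS.

Lemma row_f_span I J i : i \in I -> row_f i \in coord_span I J.
Proof.
by move=> iI; apply/memv_span; rewrite mem_cat map_f // mem_enum.
Qed.

Lemma row_g_span I J i : i \in J -> row_g i \in coord_span I J.
Proof.
by move=> iJ; apply/memv_span; rewrite mem_cat orbC map_f // mem_enum.
Qed.

Lemma lin_coord_span I J v : v \in coord_span I J -> coord_ideal W I J (lin v).
Proof.
move=> vY; apply: (ideal_lin_span (coord_ideal_is_ideal I J) vY) => t.
rewrite mem_cat => /orP[] /mapP[i iI ->]; rewrite mem_enum in iI.
  by rewrite lin_row_f; apply: coord_ideal_f.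
by rewrite lin_row_g; apply: coord_ideal_g.
Qed.

Lemma coord_ideal_ker I J :
  coord_ideal W I J = [set p | retract (coord_span I J) p = 0].
Proof.
apply/seteqP; split=> [|p p0].
  apply: coord_ideal_sub.
  - by have /prime_idealE[] := retract_ker_prime (coord_span I J).
  - by move=> i iI; rewrite /= -lin_row_f retract_lin coproj_id ?linear0 ?row_f_span.
  - by move=> i iI; rewrite /= -lin_row_g retract_lin coproj_id ?linear0 ?row_g_span.
have := retract_mod p (coord_ideal_is_ideal I J) (@lin_coord_span I J).
by rewrite [retract _ _]p0 subr0.
Qed.

Lemma coord_ideal_prime I J : prime_ideal (coord_ideal W I J).
Proof. rewrite coord_ideal_ker; exact: retract_ker_prime. Qed.

(** Clears denominators: inverting all [u i] makes each [t i] an element of the ideal of pairs. *)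
Lemma pairs_colon (t u : 'I_n -> S) x : (forall i, t i * u i = f i * g i) ->
  generated_ideal [set: 'I_n]%SET t x -> a (x * \prod_i u i).
Proof.
move=> tu; pose K := [set x | a (x * \prod_i u i)].
apply: (@generated_sub _ _ _ _ K); first exact/colon_is_ideal/pairs_is_ideal.
move=> i _; rewrite /K /= (bigD1 i) //= mulrA tu.
exact/(ideal_mulr _ pairs_is_ideal)/pairs_mem.
Qed.

Lemma prime_pairs P : prime_ideal P -> a `<=` P ->
  exists I J, [/\ forall i, i \in I <-> P (f i),
                  forall i, i \in J <-> P (g i) & (I :|: J = [set: 'I_n])%SET].
Proof.
move=> /prime_idealE[_ _ PM] sP.
exists [set i | `[< P (f i) >]]%SET, [set i | `[< P (g i) >]]%SET.
split=> [i|i|]; rewrite ?inE //.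
apply/finset.setP => i; rewrite !inE.
by case: (PM _ _ (sP _ (pairs_mem i))) => /asboolP ->; rewrite ?orbT.
Qed.

Lemma prime_separates_f P F i : prime_ideal P ->
  (forall j, j \in F -> P (f j)) -> ~ P (f i) -> separates W F i.
Proof.
by case/prime_idealE=> iP _ _; apply: separates_of_ideal iP; apply: coord_f_relation.
Qed.

Lemma prime_separates_g P F i : prime_ideal P ->
  (forall j, j \in F -> P (g j)) -> ~ P (g i) -> separates (orth W) F i.
Proof.
case/prime_idealE=> iP _ _; apply: separates_of_ideal iP.
by rewrite orthK; apply: coord_g_relation.
Qed.

(* Away from P, the ideal a becomes (t_i), which is generated by polynomials in the
   linear forms lying in P; modulo it the other linear forms are regular. *)
Lemma associated_prime_pairs P : associated_prime a P ->
  exists I J, [/\ forall i, i \notin I -> separates W I i,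
    forall j, j \notin J -> separates (orth W) J j,
    (I :|: J = [set: 'I_n])%SET & P = coord_ideal W I J].
Proof.
move=> [pP [x PE]]; have [iP P1 PM] := (prime_idealE P).1 pP.
have sP : a `<=` P.
  by move=> y ay; rewrite PE /=; apply: ideal_mulr => //; apply: pairs_is_ideal.
have [I [J [IE JE IJ]]] := prime_pairs pP sP; exists I, J.
have inJ i : i \notin I -> i \in J.
  move=> iI; have : i \in (I :|: J)%SET by rewrite IJ inE.
  by rewrite inE (negPf iI).
split=> // [i iI|j jJ|].
- by apply: (prime_separates_f pP) => [j /IE//|/IE]; apply/negP.
- by apply: (prime_separates_g pP) => [i /JE//|/JE]; apply/negP.
(* A factor of [f i * g i] outside [P] goes to [u i] and the rest to [t i]; at most one factor is
   outside since [I] and [J] cover all indices. *)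
pose t i := if i \notin I then g i else if i \notin J then f i else f i * g i.
pose u i := if i \notin I then f i else if i \notin J then g i else 1.
have tu i : t i * u i = f i * g i.
  by rewrite /t /u; case: ifP => _; [rewrite mulrC|case: ifP => _; rewrite ?mulr1].
have nu : ~ P (\prod_i u i).
  apply: prime_prod => // i _; rewrite /u.
  case: ifPn => [iI /IE|_]; first exact/negP.
  by case: ifPn => // [iJ /JE]; apply/negP.
pose b := generated_ideal [set: 'I_n]%SET t.
have ib : is_ideal b by apply: generated_is_ideal.
have sab : a `<=` b.
  apply: generated_sub => // i _; rewrite -tu.
  by apply: ideal_mulr => //; apply: generated_mem.
pose Y := coord_span I J.
have fY i : i \in I -> expand Y (f i) = (f i)%:MP.
  by move=> iI; rewrite -lin_row_f expand_fixed // row_f_span.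
have gY i : i \in J -> expand Y (g i) = (g i)%:MP.
  by move=> iJ; rewrite -lin_row_g expand_fixed // row_g_span.
have tY i : expand Y (t i) = (t i)%:MP.
  rewrite /t; case: ifPn => [/inJ /gY//|/negPn iI].
  case: ifPn => [_|/negPn iJ]; first exact: fY.
  by rewrite rmorphM /= fY // gY // mpolyCM.
have sub : coord_ideal W I J `<=` P.
  by apply: coord_ideal_sub => // i; [move/IE|move/JE].
(* Multiplying by the product of the [u i] leads back to the ideal of pairs, and that product is not
   in [P]. *)
have Pb y : b (y * x) -> P y.
  move=> /(pairs_colon tu) h; have : P (y * \prod_i u i).
    by rewrite PE /= mulrAC.
  by case/PM.
apply/seteqP; split=> // h Ph.
(* A nonzero retraction of [h] would lie in [P] and so kill [x] modulo [b]; regularity would give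
   [x] in [b], that is, 1 in [P]. *)
rewrite coord_ideal_ker /=; apply/eqP; apply: contra_notT P1 => nh.
have Prh : P (retract Y h).
  have := sub _ (retract_mod h (coord_ideal_is_ideal I J) (@lin_coord_span I J)).
  by move=> /(ideal_sub iP Ph); rewrite subKr.
apply: Pb; rewrite mul1r; apply: (retract_regular ib (expand_generated tY) nh).
by apply: sab; move: Prh; rewrite PE.
Qed.

Definition cyclic_flat_space F :=
  (forall i, i \notin F -> separates W F i) /\
  forall i, i \in F -> separates (orth W) (~: F)%SET i.

(* The cyclic flat is the closure of the set of j with g_j \notin P. *)
Lemma prime_pairs_cyclic P : prime_ideal P -> a `<=` P ->
  exists2 F, cyclic_flat_space F & coord_ideal W F (~: F)%SET `<=` P.
Proof.
move=> pP sP; have [iP _ _] := (prime_idealE P).1 pP.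
have [I [J [IE JE IJ]]] := prime_pairs pP sP.
have JI : (~: J \subset I)%SET.
  apply/fintype.subsetP => i; rewrite inE => iJ.
  have : i \in (I :|: J)%SET by rewrite IJ inE.
  by rewrite inE (negPf iJ) orbF.
pose F := [set i | `[< ~ separates W (~: J)%SET i >]]%SET.
have FP i : i \notin F -> separates W (~: J)%SET i.
  by rewrite inE => /asboolPn/contrapT.
have FJ : (~: F \subset J)%SET.
  apply/fintype.subsetP => i; rewrite inE => /FP/separates_notin.
  by rewrite inE negbK.
exists F.
  split=> i iF.
    have [w [wW wJ wi]] := FP _ iF; exists w; split=> // j.
    rewrite inE => /asboolP nsep; apply/eqP; apply: contra_notT nsep => wj.
    by exists w.
  have [iJ|iJ] := boolP (i \in J); last first.
    apply: (separatesS FJ); apply: (prime_separates_g pP) => [j /JE//|/JE].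
    exact/negP.
  have iJ' : i \notin (~: J)%SET by rewrite inE negbK.
  (* As [i] is in the closure of [~: J], the Fredholm alternative yields a vector of [orth W]
     supported on [i |: ~: J], which is contained in [F]. *)
  have : separates (orth W) (~: (i |: ~: J))%SET i.
    apply: contrapT => /(separates_orth W iJ'); move: iF; rewrite inE.
    by move/asboolP.
  apply: separatesS; apply/fintype.subsetP => j jF; rewrite !inE negb_or negbK.
  rewrite (fintype.subsetP FJ) // andbT.
  by apply: contraTneq jF => ->; rewrite finset.in_setC iF.
apply: coord_ideal_sub => // i iF; last by apply/JE/(fintype.subsetP FJ).
(* The f_j with [j] outside [J] lie in [P], and hence so do all f_i with [i] in the closure of
   [~: J]. *)
apply: contrapT => nPi; move: iF; rewrite inE => /asboolP; apply.
by apply: (prime_separates_f pP) nPi => j jJ; apply/IE/(fintype.subsetP JI).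
Qed.

Lemma pairs_sub_coord_ideal F : a `<=` coord_ideal W F (~: F)%SET.
Proof.
apply: pairs_sub; first exact: coord_ideal_is_ideal.
move=> i; have [iF|iF] := boolP (i \in F).
  by left; apply: coord_ideal_f.
by right; apply: coord_ideal_g; rewrite inE.
Qed.

(** An index in [F] but not in [G] contributes f_i, and one in [G] but not in [F] contributes g_i,
    to the first ideal but not to the second. *)
Lemma coord_ideal_antichain F G : cyclic_flat_space F -> cyclic_flat_space G ->
  coord_ideal W F (~: F)%SET `<=` coord_ideal W G (~: G)%SET -> F = G.
Proof.
move=> [F1 F2] [G1 G2] sFG; apply/finset.setP => i.
apply/idP/idP => [iF|iG]; apply: contraT => ni.
  by case: (@coord_ideal_fE G (~: G)%SET i (G1 _ ni)); apply/sFG/coord_ideal_f.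
case: (@coord_ideal_gE G (~: G)%SET i (G2 _ iG)); apply/sFG/coord_ideal_g.
by rewrite inE.
Qed.

(** The multiplier collects the partner of each generator of the prime. *)
Lemma coord_ideal_colon F x : coord_ideal W F (~: F)%SET x ->
  a (x * \prod_i (if i \in F then g i else f i)).
Proof.
move=> xF; apply: (@pairs_colon (fun i => if i \in F then f i else g i)).
  by move=> i; case: ifP => // _; rewrite mulrC.
apply: coord_ideal_sub xF; first exact: generated_is_ideal.
  move=> i iF.
  have := generated_mem (fun i => if i \in F then f i else g i) (finset.in_setT i).
  by rewrite iF.
move=> i; rewrite inE => iF.
have := generated_mem (fun i => if i \in F then f i else g i) (finset.in_setT i).
by rewrite (negPf iF).
Qed.

Lemma coord_ideal_colon_notin F : cyclic_flat_space F ->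
  ~ coord_ideal W F (~: F)%SET (\prod_i (if i \in F then g i else f i)).
Proof.
move=> [F1 F2]; apply: prime_prod => [|i _]; first exact: coord_ideal_prime.
case: ifPn => iF; [exact/coord_ideal_gE/F2|exact/coord_ideal_fE/F1].
Qed.

End IdealOfPairs.

(** * Associated primes, minimal primes and primary components *)

Local Open Scope classical_set_scope.

Theorem theorem3p10 (k : fieldType) (n : nat) (M : matroid 'I_n)
    (W : {vspace 'rV[k]_n}) (hW : linear_realization M W) :
  [/\ (* (a) *)
      forall P : set (pair_ring W), associated_prime (ideal_of_pairs W) P ->
        exists F G : {set 'I_n}, biflat M F G /\ P = coord_ideal W F G,
      (* (b) *)
      (forall P : set (pair_ring W), minimal_prime (ideal_of_pairs W) P <->
        exists F : {set 'I_n}, cyclic_flat M F /\ P = coord_ideal W F (~: F)%SET) /\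
      zero_locus (ideal_of_pairs W) =
        \bigcup_(F in [set F : {set 'I_n} | cyclic_flat M F])
          zero_locus (coord_ideal W F (~: F)%SET)
    & (* (c) *)
      forall F : {set 'I_n}, cyclic_flat M F ->
        forall Q : set (pair_ring W),
          primary_component (ideal_of_pairs W) (coord_ideal W F (~: F)%SET) Q <->
          Q = coord_ideal W F (~: F)%SET].
Proof.
have rep : represents M W.
  by move=> B; rewrite -coord_proj_bij; apply: iff_sym; case: hW.
have cycE F : cyclic_flat M F <-> cyclic_flat_space W F.
  by rewrite (cyclic_flatP rep) (flatP rep).
split; [|split|].
- move=> P /associated_prime_pairs[I [J [sI sJ IJ ->]]]; exists I, J; split=> //.
  apply/and3P; split; last exact/eqP.
    by apply/(flatP rep).
  by apply/(flatP (represents_dual rep)).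
- move=> P; split=> [[pP sP minP]|[F [/cycE cF ->]]].
    have [F /cycE cF sFP] := prime_pairs_cyclic pP sP.
    exists F; split=> //; apply/esym/minP => //; first exact: coord_ideal_prime.
    exact: pairs_sub_coord_ideal.
  split; [exact: coord_ideal_prime|exact: pairs_sub_coord_ideal|].
  (* The prime of [G] lies in [Q], hence in that of [F]; the antichain property gives [G = F], which
     pins down [Q]. *)
  move=> Q pQ sQ QF; have [G cG sGQ] := prime_pairs_cyclic pQ sQ.
  apply/seteqP; split=> //.
  by rewrite -(coord_ideal_antichain cG cF) //; apply: subset_trans QF.
- apply/seteqP; split=> [P [pP sP]|P [F /= _ [pP sP]]].
    have [F /cycE cF sFP] := prime_pairs_cyclic pP sP.
    by exists F.
  by split=> //; apply: subset_trans sP; apply: pairs_sub_coord_ideal.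
- move=> F /cycE cF; apply: primary_component_prime.
  + exact: mpoly_noetherian.
  + exact: pairs_is_ideal.
  + exact: coord_ideal_prime.
  + exact: pairs_sub_coord_ideal.
  + exact: (coord_ideal_colon_notin cF).
  + exact: coord_ideal_colon.
Qed.
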